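(* Let $F=(F_n)_{n\ge 1}$ be the Fibonacci sequence and $M^F$ its Möbius dual. The following two statements are equivalent: (a) There are no Wall-Sun-Sun primes. (b) The numbers $M^F_n$ are squarefree for all integers $n\ge 1$ with $n\neq 6$.
   Context: $F_n$ denotes the Fibonacci numbers, $F_0=0$, $F_1=1$, $F_{n+2}=F_{n+1}+F_n$. The Möbius dual of $F$ is the sequence $M^F_n=\prod_{d\mid n}F_d^{\mu(n/d)}$ ($n\ge 1$), where $\mu$ is the Möbius function; all $M^F_n$ are integers. For a prime $p$, the entry point of $p$ in $F$ is $z_F(p)=\min\{n\ge 1: p\mid F_n\}$, which exists for every prime $p$. A Wall-Sun-Sun prime is a prime $p$ with $v_p(F_{z_F(p)})>1$, where $v_p$ is the $p$-adic valuation. *)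

(* Defs.v *)
From mathcomp Require Import all_boot all_order all_algebra.

Set Implicit Arguments.
Unset Strict Implicit.
Unset Printing Implicit Defensive.

Import GRing.Theory.

Fixpoint fib (n : nat) : nat :=
  match n with
  | 0 => 0
  | 1 => 1
  | (m.+1 as k).+1 => fib k + fib m
  end.

(* Only meaningful for n > 0; the divisors n %/ d below are always positive. *)
Definition mobius (n : nat) : int :=
  if all (fun p => logn p n == 1) (primes n)
  then ((-1) ^+ size (primes n))%R else 0%R.

(* The exponents may be negative, so the product is formed in rat. *)
Definition mobius_dual (a : nat -> nat) (n : nat) : rat :=
  (\prod_(d <- divisors n) ((a d)%:R ^ mobius (n %/ d)))%R.

Definition squarefree (m : int) : Prop :=
  forall d : int, (d ^+ 2 %| m)%Z -> d \is a GRing.unit.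

(* A rational is a squarefree integer; this forces it to be an integer. *)
Definition is_squarefree_int (x : rat) : Prop :=
  exists m : int, x = (m%:~R)%R /\ squarefree m.

(* The map (F_n, F_n.+1) |-> (F_n.+1, F_n.+2) mod p is injective on a finite
   set, so the orbit of (0, 1) returns to (0, 1). *)
Lemma entry_point_ex (p : nat) : prime p -> exists n, (0 < n) && (p %| fib n).
Proof.
move=> p_pr.
pose f (u : 'Z_p * 'Z_p) : 'Z_p * 'Z_p := (u.2, (u.2 + u.1)%R).
have f_inj : injective f.
  move=> [a b] [c d] /eqP; rewrite xpair_eqE.
  by move=> /andP[/eqP /= -> /eqP /= /addrI ->].
have fibE n : iter n f (0%R, 1%R) = ((fib n)%:R%R, (fib n.+1)%:R%R).
  by elim: n => // n IHn; rewrite iterS IHn /f /= -natrD.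
have /eqP := iter_order f_inj (0%R, 1%R).
rewrite fibE xpair_eqE => /andP[/eqP fib0 _].
exists (order f (0%R, 1%R)); rewrite order_gt0 /=.
have := congr1 (@nat_of_ord _) fib0.
by rewrite val_Zp_nat ?prime_gt1 //= => /eqP.
Qed.

Definition entry_point (p : nat) (p_pr : prime p) : nat :=
  ex_minn (entry_point_ex p_pr).

Definition Wall_Sun_Sun_prime (p : nat) : Prop :=
  exists p_pr : prime p, 1 < logn p (fib (entry_point p_pr)).

(* Main.v *)
(* For a prime p with entry point z, p divides F_n iff z divides n, and
   v_p(F_n) depends only on j = v_p(n / z).  Passing from j to j + 1 raises it by
   exactly 1, except for p = 2, j = 0, where F_3 = 2 and F_6 = 8.  By Moebius
   inversion, v_p of the n-th dual term is therefore v_p(F_z) at n = z, 1 at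
   n = z p^j with j > 0 (2 at n = 6 for p = 2), and 0 at every other n. *)
Require Import Defs.
From mathcomp Require Import all_boot all_order all_algebra.
From mathcomp Require Import ring zify.

Set Implicit Arguments.
Unset Strict Implicit.
Unset Printing Implicit Defensive.

Import GRing.Theory.

(** * Addition formula and expansion of Fibonacci numbers at multiples of an index *)

Lemma fibSS n : fib n.+2 = fib n.+1 + fib n.
Proof. by []. Qed.

Lemma fib_add m n : fib (m + n).+1 = fib m.+1 * fib n.+1 + fib m * fib n.
Proof.
suff [] : fib (m + n).+1 = fib m.+1 * fib n.+1 + fib m * fib n /\
          fib (m + n).+2 = fib m.+2 * fib n.+1 + fib m.+1 * fib n by [].
elim: m => [|m [IH1 IH2]]; first by rewrite !add0n !fibSS /=; lia.
split; first by rewrite addSn IH2.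
by rewrite !addSn fibSS IH1 IH2 !fibSS; lia.
Qed.

Lemma fib_gt0 n : 0 < n -> 0 < fib n.
Proof.
case: n => // n _; elim: n => // n IHn.
by rewrite fibSS addn_gt0 IHn.
Qed.

Lemma coprime_fibS n : coprime (fib n) (fib n.+1).
Proof.
elim: n => // n IHn.
by rewrite fibSS /coprime gcdnDl gcdnC.
Qed.

Lemma fib_dvd m n : m %| n -> fib m %| fib n.
Proof.
case/dvdnP=> k ->{n}; case: m => [|m]; first by rewrite muln0.
elim: k => [|k IHk]; first by rewrite mul0n dvdn0.
by rewrite mulSn addSn fib_add dvdn_add ?[_ %| _ * fib (k * _)]dvdn_mull ?dvdn_mulr.
Qed.

(* With a = F_m and b = F_(m+1), the m-th power of the Fibonacci matrix A is
   b I + a A^-1; this is the binomial expansion of its k-th power modulo a^3. *)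
Lemma fib_mul_expansion m k (a := (fib m)%:Z%R) (b := (fib m.+1)%:Z%R) :
  exists x y : int,
    ((fib (k.+2 * m))%:Z =
       k.+2%:Z * a * b ^+ k.+1 - 'C(k.+2, 2)%:Z * a ^+ 2 * b ^+ k + a ^+ 3 * x /\
     (fib (k.+2 * m).+1)%:Z =
       b ^+ k.+2 + 'C(k.+2, 2)%:Z * a ^+ 2 * b ^+ k + a ^+ 3 * y)%R.
Proof.
have fibD N : (fib (N + m))%:Z%R
    = ((fib N)%:Z * b + (fib N.+1)%:Z * a - (fib N)%:Z * a)%R.
  rewrite /a /b; have := fib_add N m.
  have := fib_add N.+1 m; rewrite addSn !fibSS; lia.
have fibDS N : (fib (N + m).+1)%:Z%R
    = ((fib N.+1)%:Z * b + (fib N)%:Z * a)%R.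
  by rewrite fib_add PoszD !PoszM.
elim: k => [|k [x [y [IH1 IH2]]]].
  exists 0%R, 0%R; rewrite mulSn mul1n fibD fibDS binn -/a -/b.
  by split; ring.
rewrite mulSn addnC fibD fibDS IH1 IH2.
have -> : 'C(k.+3, 2)%:Z%R = ('C(k.+2, 2)%:Z + k.+2%:Z)%R
  by rewrite binS bin1 PoszD.
(* The witnesses collect all terms of degree at least 3 in [a]; the lower coefficients agree by
   Pascal's rule. *)
exists (x * b + y * a - x * a + 'C(k.+2, 2)%:Z * b ^+ k * 2)%R.
exists (y * b + x * a - 'C(k.+2, 2)%:Z * b ^+ k)%R.
have -> : k.+3%:Z%R = (k.+2%:Z + 1)%R by lia.
move: (Posz k.+2) (Posz 'C(_, _)) => K C.
by rewrite !exprS; split; ring.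
Qed.


(** * Valuation of [fib (k * m)] relative to that of [fib m] *)

Lemma fibS_ndvd p m : prime p -> p %| fib m -> ~~ (p %| fib m.+1).
Proof.
move=> p_pr p_m; apply/negP => p_m1.
have := coprime_fibS m; rewrite /coprime => /eqP gcd1.
by have := prime_gt1 p_pr; rewrite ltnNge dvdn_leq // -gcd1 dvdn_gcd p_m.
Qed.

(** The cofactor [u] lives in the integers because the expansion of [fib (k * m)] contains a
    subtraction. *)
Lemma logn_mul_int p (N a c : nat) (u : int) :
    prime p -> 0 < a -> 0 < c -> ~~ (p %| u)%Z -> N%:Z%R = (a%:Z * c%:Z * u)%R ->
  logn p N = logn p a + logn p c.
Proof.
move=> p_pr a0 c0 pu /(congr1 absz); rewrite !abszM !absz_nat => ->.
have u0 : 0 < `|u|%N by rewrite absz_gt0; apply: contraNneq pu => ->.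
by rewrite !lognM ?muln_gt0 ?a0 // [logn p `|u|]lognE -[p %| `|u|]/(p %| u)%Z
           (negPf pu) !andbF addn0.
Qed.

(** Modulo [a = fib m], the cofactor of [a] in the expansion is [k * b ^ (k - 1)], and [p] divides
    [a] but neither [k] nor [b = fib m.+1]. *)
Lemma logn_fib_coprime p m k : prime p -> p %| fib m -> 0 < m -> ~~ (p %| k) ->
  logn p (fib (k * m)) = logn p (fib m).
Proof.
move=> p_pr p_m m0; case: k => [|[|k]]; rewrite ?dvdn0 ?mul1n // => pk.
have [x [y [eF _]]] := fib_mul_expansion m k.
move: eF; set a := Posz (fib m); set b := Posz (fib m.+1); set C := Posz 'C(_, _) => eF.
rewrite -[RHS]addn0 -(logn1 p).
apply: (@logn_mul_int _ _ _ _ (k.+2%:Z * b ^+ k.+1 + a * (- C * b ^+ k + a * x))%R);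
  rewrite ?fib_gt0 //; last first.
  by rewrite eF -/a !exprS; move: (Posz k.+2) => K; ring.
rewrite rpredDr; last by rewrite dvdz_mulr.
rewrite dvdzE abszM abszX Euclid_dvdM // Euclid_dvdX // !absz_nat.
by rewrite (negPf pk) andbT fibS_ndvd.
Qed.

(** After division by [p * a], the leading term of the expansion is [b ^ (p - 1)], prime to [p]. For
    odd [p] the rest is divisible by [p] since [p] divides both [a] and ['C(p, 2)]. For [p = 2] the
    rest begins with [- a / 2], which is even once 4 divides [a]. *)
Lemma logn_fib_prime p m : prime p -> p %| fib m -> 0 < m ->
    (p = 2 -> 4 %| fib m) ->
  logn p (fib (p * m)) = (logn p (fib m)).+1.
Proof.
move=> p_pr p_m m0 p2; rewrite -[RHS]addn1.
have -> : logn p (fib m) + 1 = logn p (fib m) + logn p p.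
  by rewrite [logn p p]logn_prime ?eqxx.
have pb := fibS_ndvd p_pr p_m.
have [x [y [eF _]]] := fib_mul_expansion m (p - 2).
have Ep : (p - 2).+2 = p by have := prime_gt1 p_pr; lia.
move: eF; rewrite Ep.
set a := Posz (fib m); set b := Posz (fib m.+1) => eF.
case: (eqVneq p 2) => [p2e|p_odd].
  subst p; have /dvdnP[c ec] := p2 erefl.
  apply: (@logn_mul_int _ _ _ _ (b + 2%:Z * (- c%:Z + 4 * c%:Z ^+ 2 * x))%R);
    rewrite ?fib_gt0 //; last first.
    rewrite eF binn -/a (_ : a = (c%:Z * 4)%R) ?subnn; first by ring.
    by rewrite /a ec PoszM.
  by rewrite rpredDr ?dvdz_mulr.
have /dvdnP[c ec] : p %| 'C(p, 2).
  by apply: prime_dvd_bin => //; have := prime_gt1 p_pr; lia.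
have /dvdnP[a' ea] := p_m.
have eap : a = (a'%:Z * p%:Z)%R by rewrite /a ea PoszM.
apply: (@logn_mul_int _ _ _ _ (b ^+ (p - 2).+1
    + p%:Z * (- c%:Z * a'%:Z * b ^+ (p - 2) + a'%:Z ^+ 2 * x))%R);
  rewrite ?fib_gt0 // ?prime_gt0 //; last first.
  by rewrite eF -/a ec PoszM eap !exprS; ring.
rewrite rpredDr ?dvdz_mulr //.
by rewrite dvdzE abszX !absz_nat Euclid_dvdX // andbT.
Qed.

(** * Entry points and divisibility *)

(** A total version of [entry_point], free of the primality proof; the value 0 at non-primes is a
    dummy. *)
Definition rank p :=
  if insub p is Some q then entry_point (valP (q : {p | prime p})) else 0.

Lemma rankE p (p_pr : prime p) : rank p = entry_point p_pr.
Proof.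
by rewrite /rank insubT; congr entry_point; apply: bool_irrelevance.
Qed.

Lemma rank_gt0 p : prime p -> 0 < rank p.
Proof.
move=> p_pr; rewrite (rankE p_pr) /entry_point.
by case: ex_minnP => z /andP[].
Qed.

(** Write [n = q * z + r] with [r < z]. If [r > 0], then modulo [p] the addition formula gives
    [fib n = fib (q * z).+1 * fib r] with invertible first factor, so [p] would divide [fib r],
    against the minimality of [z]. *)
Lemma dvdn_fib p n : prime p -> (p %| fib n) = (rank p %| n).
Proof.
move=> p_pr; rewrite (rankE p_pr) /entry_point.
case: ex_minnP => z /andP[z0 p_z] z_min; apply/idP/idP; last first.
  by move=> /fib_dvd; apply: dvdn_trans.
rewrite {1}(divn_eq n z) [z %| n]/dvdn; have := ltn_pmod n z0.
case: (n %% z) => // r rz.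
have p_qz : p %| fib (n %/ z * z) by rewrite (dvdn_trans p_z) ?fib_dvd ?dvdn_mull.
rewrite addnS addnC fib_add dvdn_addl; last by rewrite dvdn_mull.
rewrite Euclid_dvdM // (negPf (fibS_ndvd p_pr p_qz)) orbF => p_r.
by have := z_min r.+1 p_r; rewrite leqNgt rz.
Qed.

Lemma rank2 : rank 2 = 3.
Proof.
have : rank 2 %| 3 by rewrite -dvdn_fib.
rewrite dvdn_divisors // !inE => /orP[]/eqP // r1.
by have := @dvdn_fib 2 1 isT; rewrite r1.
Qed.

(** * Valuations along the indices [rank p * p ^ j] *)

Definition fib_val p j := logn p (fib (rank p * p ^ j)).

Lemma rank_pow_gt0 p j : prime p -> 0 < rank p * p ^ j.
Proof. by move=> p_pr; rewrite muln_gt0 rank_gt0 // expn_gt0 prime_gt0. Qed.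

Lemma logn_fib p n : prime p -> 0 < n -> rank p %| n ->
  logn p (fib n) = fib_val p (logn p (n %/ rank p)).
Proof.
move=> p_pr n0 zn; have z0 := rank_gt0 p_pr.
have k0 : 0 < n %/ rank p by rewrite divn_gt0 // dvdn_leq.
have [c co_pc ek] := pfactor_coprime p_pr k0.
rewrite -{1}(divnK zn) {1}ek -mulnA [_ ^ _ * _]mulnC.
rewrite logn_fib_coprime ?dvdn_fib ?dvdn_mulr ?rank_pow_gt0 //.
by rewrite -prime_coprime.
Qed.

(** Ensures that the natural-number differences in [dual_val] are not truncated, so that they
    telescope. *)
Lemma fib_val_homo p : prime p -> {homo fib_val p : i j / i <= j}.
Proof.
move=> p_pr i j ij; apply: dvdn_leq_log; first by rewrite fib_gt0 ?rank_pow_gt0.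
by rewrite fib_dvd // dvdn_mul // dvdn_exp2l.
Qed.

Lemma fib_valS p j : prime p -> (p, j) <> (2, 0) ->
  fib_val p j.+1 = (fib_val p j).+1.
Proof.
move=> p_pr pj; rewrite /fib_val expnS mulnCA logn_fib_prime ?rank_pow_gt0 //.
  by rewrite dvdn_fib ?dvdn_mulr.
move=> p2; subst p; rewrite rank2; case: j pj => // j _.
(* For [p = 2] and positive exponent, the index is a multiple of 6, and [fib 6 = 8] is divisible by
   4. *)
by apply: (@dvdn_trans (fib 6)) => //; rewrite fib_dvd // expnS mulnA dvdn_mulr.
Qed.

(* The p-adic valuation of the n-th term of the Moebius dual of fib. *)
Definition dual_val p n :=
  let j := logn p (n %/ rank p) in
  if n == rank p * p ^ j
  then if j is i.+1 then fib_val p j - fib_val p i else fib_val p 0 else 0.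

Lemma dual_val_rank p : prime p -> dual_val p (rank p) = logn p (fib (rank p)).
Proof.
move=> p_pr; rewrite /dual_val divnn rank_gt0 // logn1 muln1 eqxx.
by rewrite /fib_val muln1.
Qed.

Lemma dual_val_le1 p n : prime p -> logn p (fib (rank p)) <= 1 -> n <> 6 ->
  dual_val p n <= 1.
Proof.
move=> p_pr wss n6; rewrite /dual_val.
case: eqP => // en; case: (logn _ _) en => [|j] en; first by rewrite /fib_val muln1.
(* The one jump not covered by [fib_valS] goes from index 3 to index 6, the excluded [n]. *)
rewrite fib_valS ?subSnn // => -[p2 j0]; apply: n6.
by rewrite en j0 p2 rank2.
Qed.

(** Only divisors [rank p * p ^ j] contribute. They exist only if [rank p] divides [n], and then [j]
    runs from 0 to the valuation of [n %/ rank p], so the sum telescopes. *)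
Lemma sum_dual_val p n : prime p -> 0 < n ->
  \sum_(d <- divisors n) dual_val p d = logn p (fib n).
Proof.
move=> p_pr n0; have z0 := rank_gt0 p_pr; have p0 := prime_gt0 p_pr.
rewrite -big_mkcond /=.
case zn : (rank p %| n); last first.
  rewrite [RHS]lognE dvdn_fib // zn !andbF big1_seq // => d /andP[/eqP ed].
  rewrite -dvdn_divisors // => dn; move: zn.
  by rewrite (dvdn_trans _ dn) // ed dvdn_mulr.
have k0 : 0 < n %/ rank p by rewrite divn_gt0 // dvdn_leq.
have logz j : logn p ((rank p * p ^ j) %/ rank p) = j by rewrite mulKn ?pfactorK.
rewrite -big_filter.
have /(perm_big _)-> : perm_eq
    [seq d <- divisors n | d == rank p * p ^ logn p (d %/ rank p)]
    [seq rank p * p ^ j | j <- iota 0 (logn p (n %/ rank p)).+1].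
  apply: uniq_perm; rewrite ?filter_uniq ?divisors_uniq //.
    rewrite map_inj_uniq ?iota_uniq // => i j /eqP.
    by rewrite eqn_pmul2l // eqn_exp2l ?prime_gt1 // => /eqP.
  have zjn j : (rank p * p ^ j %| n) = (j <= logn p (n %/ rank p)).
    by rewrite -{1}(divnK zn) mulnC dvdn_pmul2r // pfactor_dvdn.
  move=> d; rewrite mem_filter -dvdn_divisors //; apply/andP/mapP.
    move=> [/eqP ed dn]; exists (logn p (d %/ rank p)) => //.
    by rewrite mem_iota ltnS -zjn -ed.
  move=> [j]; rewrite mem_iota ltnS -zjn => jn ->.
  by rewrite logz eqxx.
rewrite big_map -[X in iota _ X]subn0 -/(index_iota _ _) big_nat_recl // logz.
under eq_bigr => i _ do rewrite logz.
have fib_val_h := fib_val_homo p_pr.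
by rewrite telescope_sumn // logn_fib // /= subnKC // fib_val_h.
Qed.

(** * Sums over divisors and Moebius inversion *)

Section DivisorSums.

Variables (R : Type) (idx : R) (op : Monoid.com_law idx).

(** The operation is abstract because this serves a sum in [sum_mobius] and a product in
    [mobius_inversion]. *)
Lemma big_divisors_multiple (e n : nat) (F : nat -> R) : 0 < n -> e %| n ->
  \big[op/idx]_(d <- divisors n | e %| d) F d =
    \big[op/idx]_(k <- divisors (n %/ e)) F (e * k).
Proof.
move=> n0 en; have e0 := dvdn_gt0 n0 en.
have k0 : 0 < n %/ e by rewrite divn_gt0 // dvdn_leq.
rewrite -big_filter -(big_map (muln e) xpredT).
apply: perm_big; apply: uniq_perm; rewrite ?filter_uniq ?divisors_uniq //.
  rewrite map_inj_uniq ?divisors_uniq // => i j /eqP.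
  by rewrite eqn_pmul2l // => /eqP.
move=> d; rewrite mem_filter -dvdn_divisors //; apply/andP/mapP.
  move=> [/dvdnP[k ->] dn]; exists k; last by rewrite mulnC.
  by rewrite -dvdn_divisors // dvdn_divRL.
move=> [k]; rewrite -dvdn_divisors // dvdn_divRL // mulnC => kn ->.
by rewrite dvdn_mulr.
Qed.

Lemma big_divisors_div (n : nat) (F : nat -> R) : 0 < n ->
  \big[op/idx]_(d <- divisors n) F (n %/ d) =
    \big[op/idx]_(d <- divisors n) F d.
Proof.
move=> n0; rewrite -(big_map (divn n) xpredT).
have divnI d : d %| n -> n %/ (n %/ d) = d.
  by move=> dn; rewrite divnA // mulKn.
have mem_div d : d %| n -> n %/ d %| n.
  by move=> dn; rewrite -{2}(divnK dn) dvdn_mulr.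
apply: perm_big; apply: uniq_perm; rewrite ?divisors_uniq //.
  rewrite map_inj_in_uniq ?divisors_uniq // => i j.
  by rewrite -!dvdn_divisors // => /divnI {2}<- /divnI {2}<- ->.
move=> d; rewrite -dvdn_divisors //; apply/mapP/idP => [[k]|dn].
  by rewrite -dvdn_divisors // => kn ->; apply: mem_div.
by exists (n %/ d); rewrite -?dvdn_divisors ?mem_div ?divnI.
Qed.

Lemma big_divisors_sub (d n : nat) (F : nat -> R) : 0 < n -> d %| n ->
  \big[op/idx]_(e <- divisors d) F e =
    \big[op/idx]_(e <- divisors n | e %| d) F e.
Proof.
move=> n0 dn; have d0 := dvdn_gt0 n0 dn; rewrite -[RHS]big_filter.
apply: perm_big; apply: uniq_perm; rewrite ?filter_uniq ?divisors_uniq //.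
move=> e; rewrite mem_filter -!dvdn_divisors //.
by case ed: (e %| d) => //=; rewrite (dvdn_trans ed dn).
Qed.

End DivisorSums.

Lemma mobius_mul_prime p d : prime p -> 0 < d ->
  mobius (p * d) = if p %| d then 0%R else (- mobius d)%R.
Proof.
move=> p_pr d0; have p0 := prime_gt0 p_pr.
have logpd q : logn q (p * d) = (q == p) + logn q d.
  by rewrite lognM // logn_prime.
case: ifP => pd; rewrite /mobius.
  case: allP => // /(_ p).
  rewrite mem_primes p_pr muln_gt0 p0 d0 dvdn_mulr //= logpd eqxx => /(_ isT).
  by have := pfactor_dvdn 1 p_pr d0; rewrite expn1 pd; lia.
have pnd : p \notin primes d by rewrite mem_primes pd !andbF.
have perm_pd : perm_eq (primes (p * d)) (p :: primes d).
  apply: uniq_perm; rewrite /= ?primes_uniq ?andbT //.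
  by move=> q; rewrite primesM // primes_prime // !inE.
rewrite (perm_all _ perm_pd) (perm_size perm_pd) /= logpd eqxx.
rewrite lognE p_pr d0 pd /=.
have -> : all (fun q => logn q (p * d) == 1) (primes d)
        = all (fun q => logn q d == 1) (primes d).
  apply: eq_in_all => q qd; rewrite logpd.
  by have /negPf-> : q != p by apply: contraNneq pnd => <-.
by case: all; rewrite ?oppr0 // exprS mulN1r.
Qed.

(** For a prime [p] dividing [n > 1], the divisors prime to [p] are those [d] dividing [n %/ p] with
    [p] not dividing [d]. Each cancels against [p * d]; the terms [p * d] with [p] dividing [d]
    vanish. *)
Lemma sum_mobius n : 0 < n ->
  (\sum_(d <- divisors n) mobius d = (n == 1%N)%:R)%R.
Proof.
move=> n0; have [->|n1] := eqVneq n 1; first by rewrite big_seq1.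
have p_pr : prime (pdiv n) by rewrite pdiv_prime // ltn_neqAle eq_sym n1.
move: (pdiv n) (pdiv_dvd n) p_pr => p pn p_pr.
have k0 : 0 < n %/ p by rewrite divn_gt0 ?prime_gt0 // dvdn_leq.
rewrite (bigID (fun d => p %| d)) /= big_divisors_multiple //.
have -> : (\sum_(d <- divisors n | ~~ (p %| d)%N) mobius d
           = \sum_(d <- divisors (n %/ p) | ~~ (p %| d)%N) mobius d)%R.
  rewrite -[LHS]big_filter -[RHS]big_filter.
  apply: perm_big; apply: uniq_perm; rewrite ?filter_uniq ?divisors_uniq //.
  move=> d; rewrite !mem_filter -!dvdn_divisors //; apply: andb_id2l => pd.
  by rewrite -{1}(divnK pn) Gauss_dvdl // coprime_sym prime_coprime.
rewrite [X in (_ + X)%R]big_mkcond -big_split /= big_seq big1 // => d.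
rewrite -dvdn_divisors // => /(dvdn_gt0 k0) d0; rewrite mobius_mul_prime //.
by case: ifP; rewrite ?addr0 ?addNr.
Qed.

(** After exchanging the products, the exponent of [M e] is the sum of [mobius] over the divisors of
    [n %/ e], which is 1 for [e = n] and 0 otherwise. Positivity of [M] allows adding possibly
    negative exponents. *)
Lemma mobius_inversion (a M : nat -> nat) n :
    (forall d, 0 < d -> 0 < M d) ->
    (forall d, 0 < d -> a d = \prod_(e <- divisors d) M e) -> 0 < n ->
  mobius_dual a n = (M n)%:R%R.
Proof.
move=> M0 aE n0.
transitivity (\prod_(d <- divisors n) \prod_(e <- divisors n | (e %| d)%N)
                ((M e)%:R : rat) ^ mobius (n %/ d)%N)%R.
  rewrite /mobius_dual big_seq [RHS]big_seq; apply: eq_bigr => d.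
  rewrite -dvdn_divisors // => dn.
  rewrite aE ?(dvdn_gt0 n0 dn) // natr_prod (big_divisors_sub _ _ n0 dn).
  by apply: (big_morph (fun x : rat => x ^ _)%R) => [x y|];
    rewrite ?expfzMl ?exp1rz.
rewrite (exchange_big_dep xpredT) //=.
transitivity (\prod_(e <- divisors n) ((M e)%:R : rat) ^+ (e == n))%R.
  rewrite big_seq [RHS]big_seq; apply: eq_bigr => e.
  rewrite -dvdn_divisors // => en; rewrite big_divisors_multiple //.
  have e0 := dvdn_gt0 n0 en.
  have k0 : 0 < n %/ e by rewrite divn_gt0 // dvdn_leq.
  under eq_bigr => k _ do rewrite divnMA.
  rewrite (big_divisors_div _ (fun k => _ ^ mobius k)%R) //.
  have Me0 : ((M e)%:R : rat)%R != 0%R.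
    by rewrite Num.Theory.pnatr_eq0 -lt0n M0.
  have exprz_sum := big_morph _ (fun i j => expfzDr i j Me0) (expr0z _).
  rewrite -exprz_sum.
  rewrite sum_mobius // [_ == 1%N]eq_sym eqn_div // mul1n.
  by case: eqP => _; rewrite ?expr1z ?expr0z.
rewrite (bigD1_seq n) ?divisors_uniq -?dvdn_divisors //= eqxx expr1.
by rewrite big1 ?mulr1 // => e /negPf->.
Qed.

(** * The dual sequence rebuilt from its valuations *)

Lemma logn_prod (I : Type) (r : seq I) (P : pred I) (F : I -> nat) p :
    (forall i, P i -> 0 < F i) ->
  logn p (\prod_(i <- r | P i) F i) = \sum_(i <- r | P i) logn p (F i).
Proof.
move=> F0; suff [] : 0 < \prod_(i <- r | P i) F i /\
  logn p (\prod_(i <- r | P i) F i) = \sum_(i <- r | P i) logn p (F i) by [].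
apply: (big_ind2 (fun m s => 0 < m /\ logn p m = s)) => [|m s m' s'|i Pi].
- by rewrite logn1.
- by move=> [m0 <-] [m'0 <-]; rewrite muln_gt0 m0 lognM.
- by split=> //; apply: F0.
Qed.

(** A natural number by construction, so identifying it with the dual term also yields
    integrality. *)
Definition fib_dual n := \prod_(p <- primes (fib n)) p ^ dual_val p n.

Lemma primes_pow_gt0 n (f : nat -> nat) p : p \in primes n -> 0 < p ^ f p.
Proof. by rewrite mem_primes expn_gt0 => /andP[/prime_gt0->]. Qed.

Lemma fib_dual_gt0 n : 0 < fib_dual n.
Proof.
rewrite /fib_dual big_seq; apply: prodn_cond_gt0 => p.
exact: (primes_pow_gt0 (dual_val^~ n)).
Qed.

Lemma logn_fib_dual p n : prime p -> 0 < n -> logn p (fib_dual n) = dual_val p n.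
Proof.
move=> p_pr n0; rewrite /fib_dual big_seq logn_prod; last first.
  exact: (primes_pow_gt0 (dual_val^~ n)).
rewrite -big_seq; under eq_big_seq => q.
  rewrite mem_primes => /andP[q_pr _]; rewrite lognX logn_prime //.
  over.
case p_n: (p \in primes (fib n)).
  rewrite (bigD1_seq p) ?primes_uniq //= eqxx muln1 big1 ?addn0 // => q.
  by rewrite eq_sym => /negPf->; rewrite muln0.
rewrite big_seq big1 => [|q qn]; last first.
  by case: eqP p_n => [->|_]; rewrite ?qn ?muln0.
(* If [p] does not divide [fib n], then [rank p] does not divide [n], so the equality test in
   [dual_val] fails. *)
move: p_n; rewrite mem_primes p_pr fib_gt0 //= dvdn_fib // /dual_val.
by case: eqP => // en; rewrite {1}en dvdn_mulr.
Qed.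

Lemma fib_prod_dual n : 0 < n -> fib n = \prod_(d <- divisors n) fib_dual d.
Proof.
move=> n0; apply: eqn_from_log => [||p].
- exact: fib_gt0.
- by apply: prodn_gt0 => d; apply: fib_dual_gt0.
case p_pr: (prime p); last by rewrite [LHS]lognE [RHS]lognE p_pr.
rewrite logn_prod => [|d _]; last exact: fib_dual_gt0.
rewrite -sum_dual_val // big_seq [RHS]big_seq; apply: eq_bigr => d.
by rewrite -dvdn_divisors // => /(dvdn_gt0 n0) d0; rewrite logn_fib_dual.
Qed.

(** * Squarefreeness and the equivalence *)

Lemma is_squarefree_intP m : 0 < m ->
  is_squarefree_int m%:R%R <-> (forall p, prime p -> logn p m <= 1).
Proof.
move=> m0; split=> [[k [ek sqf]] p p_pr|sqf].
  rewrite leqNgt -pfactor_dvdn //; apply/negP => p2m.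
  have {}ek : Posz m = k by apply: (@intr_inj rat); rewrite -ek.
  have := sqf p; rewrite -ek dvdzE abszX /= => /(_ p2m).
  by have := prime_gt1 p_pr; rewrite -[_ \is a _]/((_ == _) || (_ == _)); lia.
exists (Posz m); split=> // d; rewrite dvdzE abszX /= => d2m.
suff : `|d|%N = 1 by rewrite -[_ \is a _]/((_ == _) || (_ == _)); lia.
apply/eqP; apply: contraLR m0 => d1; rewrite -leqNgt leqn0.
apply/contraT; rewrite -lt0n => m0.
(* A [d] of absolute value other than 1 has a prime factor, whose square divides [m]; [d = 0] is
   ruled out by [m > 0]. *)
have q_pr : prime (pdiv `|d|).
  apply: pdiv_prime; rewrite ltn_neqAle eq_sym d1.
  by case: `|d|%N d2m => //; rewrite dvd0n; lia.
have := sqf _ q_pr; rewrite leqNgt -pfactor_dvdn //.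
by rewrite (dvdn_trans _ d2m) // dvdn_exp2r ?pdiv_dvd.
Qed.

Theorem corollary5p1 :
  ~ (exists p : nat, Wall_Sun_Sun_prime p) <->
  (forall n : nat, 1 <= n -> n <> 6 ->
     is_squarefree_int (mobius_dual fib n)).
Proof.
have dualE n : 0 < n ->
    is_squarefree_int (mobius_dual fib n) <->
    (forall p, prime p -> dual_val p n <= 1).
  move=> n0; rewrite (mobius_inversion (fun d _ => fib_dual_gt0 d) fib_prod_dual) //.
  rewrite is_squarefree_intP ?fib_dual_gt0 //.
  by split=> H p p_pr; have := H p p_pr; rewrite logn_fib_dual.
split=> [no_wss n n0 n6|sqf [p [p_pr]]].
  apply/dualE => // p p_pr; apply: dual_val_le1 => //.
  rewrite leqNgt; apply/negP => wss; apply: no_wss; exists p, p_pr.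
  by rewrite -rankE.
rewrite -rankE ltnNge -dual_val_rank // => /negP; apply.
(* Squarefreeness is applied at the index [rank p]. It is not 6: otherwise [p] divides
   [fib 6 = 2 ^ 3], so [p = 2], whose rank is 3. *)
apply: ((dualE _ _).1 (sqf _ _ _) _ p_pr); rewrite ?rank_gt0 // => r6.
have : p %| 2 ^ 3 by rewrite (dvdn_fib 6 p_pr) r6.
rewrite Euclid_dvdX // => /andP[/(@dvdn_leq _ 2 isT) p2 _].
have e2 : p = 2 by have := prime_gt1 p_pr; lia.
by move: r6; rewrite e2 rank2.
Qed.
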